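(* Let $D$ be a weighted oriented graph with vertex set $\{x_1,\dots,x_n\}$, let $K$ be a field and let $I(D)\subseteq R=K[x_1,\dots,x_n]$ be the edge ideal of $D$. If $\mathcal{C}_s$ is the set of strong vertex covers of $D$, then the irredundant irreducible decomposition of $I(D)$ is given by $I(D)=\bigcap_{C\in\mathcal{C}_s} I_C$.
   Context: A weighted oriented graph is a triplet $D=(V(D),E(D),w)$ where $V=V(D)$ is a finite set, $E=E(D)\subseteq V\times V$ is the edge set of an oriented graph (no loops, and for $x\neq y$ at most one of $(x,y),(y,x)$ is in $E$), and $w:V\to\mathbb{N}=\{1,2,\dots\}$ is the weight function. Put $V^{+}=\{x\in V: w(x)\neq 1\}$. For $x\in V$: $N_D^{+}(x)=\{y:(x,y)\in E\}$, $N_D^{-}(x)=\{y:(y,x)\in E\}$, $N_D(x)=N_D^+(x)\cup N_D^-(x)$. A source is a vertex $x$ with $N_D(x)=N_D^+(x)$. Standing assumption: if $x$ is a source of $D$, then $w(x)=1$. Vertices are identified with the variables of $R=K[x_1,\dots,x_n]$, $K$ a field. The edge ideal is $I(D)=(x_ix_j^{w(x_j)} : (x_i,x_j)\in E)\subseteq R$. A vertex cover of $D$ is a subset $C\subseteq V$ such that for every $(x,y)\in E$, $x\in C$ or $y\in C$. For a vertex cover $C$, with $C^c=V\setminus C$, define $L_1(C)=\{x\in C: N_D^{+}(x)\cap C^c\neq\emptyset\}$, $L_2(C)=\{x\in C: x\notin L_1(C)\text{ and }N_D^{-}(x)\cap C^c\neq\emptyset\}$, $L_3(C)=C\setminus(L_1(C)\cup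 L_2(C))$. A vertex cover $C$ is strong if for each $x\in L_3(C)$ there is $(y,x)\in E$ such that $y\in L_2(C)\cup L_3(C)$ and $y\in V^{+}$. The irreducible ideal associated to a vertex cover $C$ is $I_C=\bigl(L_1(C)\cup\{x_j^{w(x_j)} : x_j\in L_2(C)\cup L_3(C)\}\bigr)\subseteq R$. An irreducible monomial ideal is an ideal of the form $(x_{i_1}^{a_1},\dots,x_{i_s}^{a_s})$ with distinct variables and positive exponents. Every monomial ideal $I$ has a unique (up to order) decomposition $I=\mathfrak q_1\cap\cdots\cap\mathfrak q_r$ into irreducible monomial ideals with $I\neq\bigcap_{i\neq j}\mathfrak q_i$ for each $j$; it is called the irredundant irreducible decomposition of $I$. *)

(* Defs.v *)
From mathcomp Require Import all_boot all_algebra.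
From mathcomp Require Import mpoly.

Set Implicit Arguments.
Unset Strict Implicit.
Unset Printing Implicit Defensive.

Import GRing.Theory.
Local Open Scope ring_scope.

(* The vertices are 'I_n, so that the vertex i is the variable 'X_i. *)
Record wograph (n : nat) := WOGraph {
  edges : {set 'I_n * 'I_n};
  weight : 'I_n -> nat;
  edges_loopless : forall x, (x, x) \notin edges;
  edges_oriented : forall x y, x != y ->
    ~~ (((x, y) \in edges) && ((y, x) \in edges));
  weight_gt0 : forall x, (0 < weight x)%N
}.

Section Graph.
Variables (n : nat) (D : wograph n).

Definition Vplus : {set 'I_n} := [set x | weight D x != 1%N].

Definition outN (x : 'I_n) : {set 'I_n} := [set y | (x, y) \in edges D].
Definition inN (x : 'I_n) : {set 'I_n} := [set y | (y, x) \in edges D].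
Definition nbh (x : 'I_n) : {set 'I_n} := outN x :|: inN x.

Definition is_source (x : 'I_n) : bool := nbh x == outN x.

Definition vertex_cover (C : {set 'I_n}) : bool :=
  [forall x, forall y, ((x, y) \in edges D) ==> ((x \in C) || (y \in C))].

Definition L1 (C : {set 'I_n}) : {set 'I_n} :=
  [set x in C | outN x :&: ~: C != set0].
Definition L2 (C : {set 'I_n}) : {set 'I_n} :=
  [set x in C | (x \notin L1 C) && (inN x :&: ~: C != set0)].
Definition L3 (C : {set 'I_n}) : {set 'I_n} := C :\: (L1 C :|: L2 C).

Definition strong_vertex_cover (C : {set 'I_n}) : bool :=
  vertex_cover C &&
  [forall x in L3 C, exists y,
     [&& (y, x) \in edges D, y \in L2 C :|: L3 C & y \in Vplus]].

Definition strong_covers : {set {set 'I_n}} :=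
  [set C | strong_vertex_cover C].

End Graph.

Section Ideals.
Variables (n : nat) (K : fieldType).
Local Notation R := {mpoly K[n]}.

(* Ideals are given by their membership predicates and compared
   extensionally. *)
Definition same_ideal (I J : R -> Prop) : Prop := forall p, I p <-> J p.

Definition ideal_gen (S : R -> Prop) : R -> Prop := fun p =>
  exists s : seq (R * R),
    (forall c, c \in s -> S c.2) /\ p = \sum_(c <- s) c.1 * c.2.

Definition edge_ideal (D : wograph n) : R -> Prop :=
  ideal_gen (fun f => exists i j : 'I_n,
    (i, j) \in edges D /\ f = 'X_i * 'X_j ^+ weight D j).

Definition cover_ideal (D : wograph n) (C : {set 'I_n}) : R -> Prop :=
  ideal_gen (fun f =>
    (exists2 i : 'I_n, i \in L1 D C & f = 'X_i) \/
    (exists2 j : 'I_n, j \in L2 D C :|: L3 D C & f = 'X_j ^+ weight D j)).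

(* The zero ideal (A empty) counts as irreducible: it is the edge ideal of a
   graph without edges. *)
Definition irreducible_monomial_ideal (I : R -> Prop) : Prop :=
  exists (A : {set 'I_n}) (a : 'I_n -> nat),
    (forall i, i \in A -> (0 < a i)%N) /\
    same_ideal I (ideal_gen (fun f => exists2 i, i \in A & f = 'X_i ^+ a i)).

Definition bigcap_ideal (T : finType) (P : {set T}) (q : T -> R -> Prop) :
  R -> Prop := fun p => forall t, t \in P -> q t p.

Definition irredundant_irreducible_decomposition
    (I : R -> Prop) (T : finType) (P : {set T}) (q : T -> R -> Prop) : Prop :=
  [/\ forall t, t \in P -> irreducible_monomial_ideal (q t),
      same_ideal I (bigcap_ideal P q) &
      forall t, t \in P -> ~ same_ideal I (bigcap_ideal (P :\ t) q)].

End Ideals.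

(* Main.v *)
Require Import Defs.
From mathcomp Require Import all_boot all_algebra.
From mathcomp Require Import mpoly.

(** A monomial ['X_[m]] lies in the ideal of a vertex cover [C] iff [m] is
    positive somewhere on [L1 C] or reaches the weight somewhere on [C].  If
    ['X_[m]] is not in the edge ideal, the set of vertices where [m] stays below
    the weight is a cover whose ideal misses ['X_[m]]; an inclusion-minimal such
    cover is strong, as a vertex of [L3] violating the strongness condition could
    be removed.  For irredundancy, the monomial that vanishes on [L1 C], equals
    the weight minus one on [L2 C] and [L3 C], and equals the weight outside [C],
    is missed by the ideal of the strong cover [C] but lies in the ideal of every
    other vertex cover. *)

Set Implicit Arguments.
Unset Strict Implicit.
Unset Printing Implicit Defensive.

Import GRing.Theory.
Local Open Scope ring_scope.

(** * Membership in monomial ideals, tested on supports *)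

Section MonomialIdeals.
Variables (n : nat) (K : fieldType).
Implicit Types (p : {mpoly K[n]}) (m g : 'X_{1..n}).

Lemma ideal_gen_ext (S T : {mpoly K[n]} -> Prop) :
  (forall f, S f <-> T f) -> same_ideal (ideal_gen S) (ideal_gen T).
Proof.
by move=> ST p; split=> -[s [sS ->]]; exists s; split=> // c /sS /ST.
Qed.

(** A monomial in the support of a combination comes from one of its summands, so a generator
    divides it. Conversely each term of [p] is a multiple of some generator, and [p] is the sum of
    its terms. *)
Lemma ideal_gen_monomialP (G : 'X_{1..n} -> Prop) p :
  ideal_gen (fun f => exists2 g, G g & f = 'X_[g]) p <->
  (forall m, m \in msupp p -> exists2 g, G g & (g <= m)%MM).
Proof.
split=> [[s [sG ->]] m|Gp].
  move=> /msupp_sum_le /flattenP[_ /mapP[c cs ->]].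
  rewrite mem_filter /= in cs; have [g Gg ->] := sG _ cs.
  rewrite (perm_mem (msuppMX _ _)) => /mapP[m' _ ->].
  by exists g => //; rewrite lem_addr.
have [s [sG sE]] : exists s : seq ({mpoly K[n]} * {mpoly K[n]}),
    (forall c, c \in s -> exists2 g, G g & c.2 = 'X_[g]) /\
    \sum_(m <- msupp p) p@_m *: 'X_[m] = \sum_(c <- s) c.1 * c.2.
  elim: (msupp p) Gp => [|m r IHr] Gp.
    by exists [::]; split=> //; rewrite !big_nil.
  have [|s [sG sE]] := IHr.
    by move=> m' m'r; apply: Gp; rewrite inE m'r orbT.
  have [g Gg le_gm] := Gp m (mem_head _ _).
  exists ((p@_m *: 'X_[m - g], 'X_[g]) :: s); split.
    by move=> c; rewrite inE => /predU1P[->|/sG //]; exists g.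
  by rewrite !big_cons sE /= -scalerAl -mpolyXD submK.
by exists s; split=> //; rewrite [p in LHS]mpolyE.
Qed.

Lemma lepm_mnm1Mn (i : 'I_n) k m : (U_(i) *+ k <= m)%MM = (k <= m i)%N.
Proof.
apply/mnm_lepP/idP => [/(_ i)|le_km j].
  by rewrite mulmnE mnm1E eqxx mul1n.
by rewrite mulmnE mnm1E; case: eqP => [<-|_]; rewrite ?mul1n.
Qed.

(** Distinctness keeps the two exponents from adding up in one variable. *)
Lemma lepm_mnm1D (i j : 'I_n) k m : i != j ->
  (U_(i) + U_(j) *+ k <= m)%MM = (0 < m i)%N && (k <= m j)%N.
Proof.
move=> ne_ij; apply/mnm_lepP/andP => [le_m|[lt0mi le_kmj] l].
  have := le_m i; have := le_m j; rewrite !mnmDE !mulmnE !mnm1E !eqxx.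
  by rewrite (negbTE ne_ij) eq_sym (negbTE ne_ij) mul1n addn0.
rewrite mnmDE mulmnE !mnm1E; case: (i =P l) => [<-|_].
  by rewrite eq_sym (negbTE ne_ij).
by case: eqP => [<-|]; rewrite ?mul1n.
Qed.

End MonomialIdeals.

(** * Covers and monomials, at the level of exponents *)

Section Covers.
Variables (n : nat) (D : wograph n).
Implicit Types (C : {set 'I_n}) (m : 'X_{1..n}).
Local Notation w := (weight D).

Lemma L2U3E C : L2 D C :|: L3 D C = C :\: L1 D C.
Proof.
apply/setP=> x; rewrite !inE.
by case: (x \in C) => //=; case: (outN D x :&: _ != _) => //=; case: (_ != _).
Qed.

Lemma L1P C x :
  reflect (x \in C /\ exists2 y, (x, y) \in edges D & y \notin C) (x \in L1 D C).
Proof.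
rewrite inE; apply: (iffP andP) => -[xC].
  by case/set0Pn=> y; rewrite !inE => /andP[xy yC]; split=> //; exists y.
by case=> y xy yC; split=> //; apply/set0Pn; exists y; rewrite !inE xy.
Qed.

Lemma L3P C x :
  reflect [/\ x \in C, forall y, (x, y) \in edges D -> y \in C &
             forall y, (y, x) \in edges D -> y \in C] (x \in L3 D C).
Proof.
have xL3 : (x \in L3 D C) =
    [&& x \in C, outN D x :&: ~: C == set0 & inN D x :&: ~: C == set0].
  rewrite !inE; case: (x \in C) => //=; rewrite ?andbF // andbT.
  by case: (outN D x :&: _ =P _) => //= _; rewrite negbK.
rewrite xL3 !setI_eq0 !disjoints_subset setCK.
apply: (iffP and3P) => -[xC].
  move=> /subsetP out_C /subsetP in_C.
  by split=> // y xy; [apply: out_C | apply: in_C]; rewrite inE.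
by move=> out_C in_C; split=> //; apply/subsetP=> y; rewrite inE; auto.
Qed.

Lemma vertex_coverP C :
  reflect (forall x y, (x, y) \in edges D -> (x \in C) || (y \in C))
          (vertex_cover D C).
Proof.
apply: (iffP forallP) => [cov x y xy|cov x].
  by have /forallP/(_ y)/implyP := cov x; apply.
by apply/forallP=> y; apply/implyP=> /cov.
Qed.

Definition edge_mem m :=
  [exists e in edges D, (0 < m e.1)%N && (w e.2 <= m e.2)%N].

(** The second alternative is also allowed on [L1]; this is harmless, since weights are positive and
    it then implies the first. *)
Definition cover_mem C m :=
  [exists i in C, (i \in L1 D C) && (0 < m i)%N || (w i <= m i)%N].

Lemma edge_memPn m :
  reflect (forall x y, (x, y) \in edges D -> (0 < m x)%N -> (m y < w y)%N)
          (~~ edge_mem m).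
Proof.
apply: (iffP idP) => [|edge_lt].
  rewrite negb_exists_in => /forall_inP edge_lt x y xy lt0mx.
  by have := edge_lt _ xy; rewrite /= lt0mx /= -ltnNge.
rewrite negb_exists_in; apply/forall_inP=> -[x y] xy /=.
by apply/negP => /andP[/(edge_lt _ _ xy)]; rewrite ltnNge => /negP.
Qed.

Lemma cover_memPn C m :
  reflect ((forall i, i \in L1 D C -> m i = 0%N) /\
           (forall i, i \in C -> (m i < w i)%N))
          (~~ cover_mem C m).
Proof.
rewrite negb_exists_in; apply: (iffP forall_inP) => [Cm|[L1m Cm] i iC].
  split=> i iC; last by have := Cm i iC; rewrite negb_or -ltnNge => /andP[].
  have [iC' _] := L1P _ _ iC.
  by have := Cm i iC'; rewrite iC negb_or -leqNgt leqn0 => /andP[/eqP].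
rewrite negb_or -ltnNge Cm // andbT.
by apply/negP => /andP[/L1m ->].
Qed.

(** Suppose [C] misses [m] and take an edge from [x] to [y]. If [y] is in [C], then [m] is below the
    weight at [y]; otherwise [x] is in [L1 D C], where [m] vanishes. *)
Lemma edge_mem_cover C m : vertex_cover D C -> edge_mem m -> cover_mem C m.
Proof.
move=> /vertex_coverP cov; apply: contraLR => /cover_memPn[L1m Cm].
apply/edge_memPn => x y xy lt0mx; have [/Cm //|yC] := boolP (y \in C).
have xL1 : x \in L1 D C.
  apply/L1P; split; last by exists y.
  by have := cov _ _ xy; rewrite (negbTE yC) orbF.
by rewrite (L1m x) in lt0mx.
Qed.

Lemma strong_cover_avoiding m : ~~ edge_mem m ->
  exists2 C, strong_vertex_cover D C & ~~ cover_mem C m.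
Proof.
move=> /edge_memPn edge_lt.
pose P C := vertex_cover D C && ~~ cover_mem C m.
(* Along an edge from [x] to [y], [m x >= w x > 0] forces [m y < w y], so this is a cover; and
   [m y >= w y] forces [m x = 0], so [m] vanishes on its [L1]. *)
have P0 : P [set x | (m x < w x)%N].
  apply/andP; split.
    apply/vertex_coverP => x y xy; rewrite !inE.
    case: ltnP => //= le_wm; apply: edge_lt xy _.
    exact: leq_trans (weight_gt0 D x) le_wm.
  apply/cover_memPn; split=> [x /L1P[_ [y xy]]|x]; rewrite inE // -leqNgt => le_wm.
  apply/eqP; rewrite -leqn0 leqNgt; apply/negP => /(edge_lt _ _ xy).
  by rewrite ltnNge le_wm.
have [C /minsetP[/andP[cov Cm] minC] _] := minset_exists P0.
exists C => //; rewrite /strong_vertex_cover cov; apply/forall_inP => x xL3.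
have [L1m Clt] := cover_memPn _ _ Cm.
apply: contraT => /existsPn weak.
have [xC outC inC] := L3P _ _ xL3.
suff /minC/(_ (subsetDl _ _)) eqC : P (C :\ x) by rewrite -eqC !inE eqxx in xC.
apply/andP; split.
  apply/vertex_coverP => y z yz; rewrite !in_setD1.
  have [yx|_] /= := eqVneq y x.
    have := edges_loopless D x; subst y.
    by case: eqP yz => [-> ->|_ /outC ->] //.
  have [zx|_] /= := eqVneq z x; last exact: (vertex_coverP _ cov).
  by rewrite inC // -zx.
apply/cover_memPn; split=> [y|y]; last by rewrite in_setD1 => /andP[_ /Clt].
case/L1P; rewrite in_setD1 => /andP[_ yC] [z yz].
(* Outside [L1 D C], all out-neighbours of [y] are in [C], so the one missing from [C :\ x] is [x]
   itself. *)
have [yL1 _|yL1] := boolP (y \in L1 D C); first exact: L1m.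
rewrite in_setD1 negb_and negbK => /predU1P[zx|zC]; last first.
  by case/negP: yL1; apply/L1P; split=> //; exists z.
subst z.
(* As strongness fails at [x], the vertex [y] has weight 1, and [m y < 1] gives the required
   vanishing. *)
have := weak y; rewrite yz L2U3E in_setD yL1 yC /= inE negbK => /eqP wy.
by have := Clt _ yC; rewrite wy ltnS leqn0 => /eqP.
Qed.

Definition cover_witness C : 'X_{1..n} :=
  [multinom if x \in L1 D C then 0%N else if x \in C then (w x).-1 else w x | x < n].

Lemma cover_witness_avoids C : ~~ cover_mem C (cover_witness C).
Proof.
apply/cover_memPn; split=> x xC; rewrite mnmE ?xC //.
by case: ifP => _; rewrite ?ltn_predL weight_gt0.
Qed.

(** The witness reaches the weight outside [C], so [C'] lies in [C]. A vertex [x] of [C] missing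
    from [C'] has all its neighbours in [C'], hence is in [L3 D C]. Strongness gives an edge from
    some [y] to [x] with [w y > 1] and [y] outside [L1 D C]. But [y] is in [L1 D C'], so the witness
    value [w y - 1] would have to be 0. *)
Lemma cover_witness_unique C C' :
    strong_vertex_cover D C -> vertex_cover D C' ->
  ~~ cover_mem C' (cover_witness C) -> C' = C.
Proof.
move=> /andP[_ /forall_inP strC] /vertex_coverP cov /cover_memPn[L1m Clt].
have sC'C : C' \subset C.
  apply/subsetP => x /Clt; rewrite mnmE; case: ifP => [/L1P[]//|_].
  by case: ifP => //; rewrite ltnn.
apply/eqP; rewrite eqEsubset sC'C; apply/subsetP => x xC.
apply/negPn/negP => xC'.
have outC' y : (x, y) \in edges D -> y \in C'.
  by move=> /cov; rewrite (negbTE xC').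
have inC' y : (y, x) \in edges D -> y \in C'.
  by move=> /cov; rewrite (negbTE xC') orbF.
have xL3 : x \in L3 D C.
  by apply/L3P; split=> // y => [/outC'|/inC']; apply: (subsetP sC'C).
have /existsP[y /and3P[yx]] := strC x xL3.
rewrite L2U3E in_setD => /andP[yL1 yC]; rewrite inE => wy.
have /L1m : y \in L1 D C' by apply/L1P; split; [apply: inC' | exists x].
rewrite mnmE (negbTE yL1) yC => wy0.
by have := weight_gt0 D y; case: (w y) wy wy0 => [|[]].
Qed.

(** * Transfer from exponents to ideals *)

Variable K : fieldType.

Lemma edge_idealP (p : {mpoly K[n]}) :
  edge_ideal D p <-> (forall m, m \in msupp p -> edge_mem m).
Proof.
have edge_ne x y : (x, y) \in edges D -> x != y.
  by apply: contraTneq => ->; exact: edges_loopless.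
pose G g := exists2 e, e \in edges D & g = (U_(e.1) + U_(e.2) *+ w e.2)%MM.
have GE f : (exists i j : 'I_n, (i, j) \in edges D /\ f = 'X_i * 'X_j ^+ w j)
    <-> (exists2 g, G g & f = 'X_[g] :> {mpoly K[n]}).
  split=> [[i [j [ij ->]]]|[_ [[i j] ij ->] ->]].
    by exists (U_(i) + U_(j) *+ w j)%MM; [exists (i, j) | rewrite mpolyXD mpolyXn].
  by exists i, j; rewrite mpolyXD mpolyXn.
apply: iff_trans (ideal_gen_ext GE p) (iff_trans (ideal_gen_monomialP _ _) _).
split=> Gp m /Gp.
  case=> _ [[x y] xy ->]; rewrite lepm_mnm1D ?edge_ne // => le_m.
  by apply/exists_inP; exists (x, y).
case/exists_inP=> -[x y] xy le_m; exists (U_(x) + U_(y) *+ w y)%MM.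
  by exists (x, y).
by rewrite lepm_mnm1D ?edge_ne.
Qed.

(** Merges the two kinds of generators into one pure power for each vertex of [C], the shape that
    irreducibility asks for. *)
Definition cover_exponent C i := if i \in L1 D C then 1%N else w i.

Lemma cover_ideal_pure_powers C :
  same_ideal (@cover_ideal n K D C)
    (ideal_gen (fun f => exists2 i, i \in C & f = 'X_i ^+ cover_exponent C i)).
Proof.
apply: ideal_gen_ext => f; rewrite L2U3E /cover_exponent; split.
  case=> -[i iC ->]; exists i; first by case/L1P: iC.
  - by rewrite iC.
  - by case/setDP: iC.
  - by rewrite in_setD in iC; case/andP: iC => /negbTE ->.
case=> i iC ->; case: ifP => [iL1|/negbT iL1]; first by left; exists i.
by right; exists i; rewrite // in_setD iL1.
Qed.

Lemma cover_exponent_le C m i : i \in C ->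
  (cover_exponent C i <= m i)%N = (i \in L1 D C) && (0 < m i)%N || (w i <= m i)%N.
Proof.
move=> iC; rewrite /cover_exponent; case: ifP => //= _.
have := weight_gt0 D i; case: (leqP (w i) (m i)) => [|_ _]; last by rewrite orbF.
by move=> le_wm lt0w; rewrite orbT (leq_trans lt0w).
Qed.

Lemma cover_idealP C (p : {mpoly K[n]}) :
  cover_ideal D C p <-> (forall m, m \in msupp p -> cover_mem C m).
Proof.
pose G g := exists2 i, i \in C & g = (U_(i) *+ cover_exponent C i)%MM.
have GE f : (exists2 i, i \in C & f = 'X_i ^+ cover_exponent C i)
    <-> (exists2 g, G g & f = 'X_[g] :> {mpoly K[n]}).
  split=> [[i iC ->]|[_ [i iC ->] ->]]; last by exists i; rewrite ?mpolyXn.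
  by exists (U_(i) *+ cover_exponent C i)%MM; [exists i | rewrite mpolyXn].
apply: iff_trans (cover_ideal_pure_powers C p) _.
apply: iff_trans (ideal_gen_ext GE p) (iff_trans (ideal_gen_monomialP _ _) _).
split=> Gp m /Gp.
  case=> _ [i iC ->]; rewrite lepm_mnm1Mn cover_exponent_le // => le_m.
  by apply/exists_inP; exists i.
case/exists_inP=> i iC le_m; exists (U_(i) *+ cover_exponent C i)%MM.
  by exists i.
by rewrite lepm_mnm1Mn cover_exponent_le.
Qed.

Lemma cover_ideal_irreducible C :
  irreducible_monomial_ideal (@cover_ideal n K D C).
Proof.
exists C, (cover_exponent C); split; last exact: cover_ideal_pure_powers.
by move=> i _; rewrite /cover_exponent; case: ifP; rewrite ?weight_gt0.
Qed.

End Covers.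

Theorem theorem3p11 (n : nat) (K : fieldType) (D : wograph n)
    (source_weight : forall x : 'I_n, is_source D x -> weight D x = 1%N) :
  irredundant_irreducible_decomposition
    (@edge_ideal n K D) (strong_covers D) (@cover_ideal n K D).
Proof.
split=> [C _|p|C]; first exact: cover_ideal_irreducible.
  rewrite edge_idealP; split=> [Ip C|Ip m mp].
    rewrite inE => /andP[cov _]; apply/cover_idealP => m /Ip.
    exact: edge_mem_cover.
  apply: contraT => /strong_cover_avoiding[C strC /negP[]].
  by move: m mp; apply/cover_idealP/Ip; rewrite inE.
rewrite inE => strC eqI.
(* If [C] could be dropped, the witness monomial, lying in all the other ideals, would lie in the
   edge ideal and hence in the ideal of [C]. *)
have /eqI/edge_idealP/(_ (cover_witness D C)) :
    bigcap_ideal (strong_covers D :\ C) (@cover_ideal n K D) 'X_[cover_witness D C].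
  move=> C'; rewrite !inE => /andP[neC /andP[cov _]]; apply/cover_idealP => m.
  rewrite msuppX inE => /eqP ->; apply: contraNT neC.
  by move=> /cover_witness_unique ->.
rewrite msuppX inE eqxx => /(_ isT).
case/andP: strC => cov _ /(edge_mem_cover cov).
exact/negP/cover_witness_avoids.
Qed.
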